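(* The poset $\Sigma_m^kC_m^n$ is isomorphic to the sublattice of $C_m^{n+k}$ consisting of those elements $(x_1,\dots,x_{n+k})$ that satisfy: for each $i\in\{1,\dots,n\}$, $x_i\leqslant x_{n+1}\leqslant x_{n+2}\leqslant\dots\leqslant x_{n+k}$.
   Context: $C_m$ denotes the chain $\{0,1,\dots,m\}$ with $m+1$ elements, and $C^n_m$ its $n$-th cartesian power with the componentwise order. Consider the sequence $C^n_0\to C^n_1\to C^n_2\to\cdots$, where each map $C^n_i\to C^n_{i+1}$ is the coordinatewise inclusion induced by the inclusion $C_i\subseteq C_{i+1}$ (a down-closed sub-join-semilattice). For a sequence of posets and monotone maps $f_i\colon M_i\to M_{i+1}$, the lax sum (lax colimit in the 2-category of posets) $\Sigma_nM_n$ is the set of pairs $(x,j)$ with $j\in\{0,\dots,n\}$ and $x\in M_j$, ordered by $(x,j)\leqslant(y,k)$ iff $j\leqslant k$ and $(f_{k-1}\circ\dots\circ f_j)(x)\leqslant y$ (with the composite being the identity when $j=k$). The lax sums form a new sequence $\Sigma_0M_0\to\Sigma_1M_1\to\cdots$ via the maps $(x,j)\mapsto(x,j)$; iterating the construction $k$ times gives $\Sigma^k_nM_n$, with $\Sigma^0_nM_n=M_n$ and $\Sigma^1_nM_n=\Sigma_nM_n$. Here $\Sigma^k_mC^n_m$ is the $k$-th iterated lax sum of the sequence $C^n_0\to C^n_1\to\cdots$ taken at index $m$. *)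

(* Defs.v *)
From HB Require Import structures.
From mathcomp Require Import all_boot all_order.

Set Implicit Arguments.
Unset Strict Implicit.
Unset Printing Implicit Defensive.

Import Order.TTheory.
Local Open Scope order_scope.

Record posetSeq (d : Order.disp_t) := PosetSeq {
  pobj :> nat -> porderType d;
  pmap : forall i, pobj i -> pobj i.+1;
  pmap_homo : forall i, {homo @pmap i : x y / x <= y}
}.

Section LaxSum.
Variables (d : Order.disp_t) (M : posetSeq d).

Fixpoint pshift (j e : nat) (x : M j) : M (e + j)%N :=
  if e is e'.+1 then pmap (pshift e' x) else x.

(* The composite f_(k-1) o ... o f_j; the cast is along k - j + j = k. *)
Definition ptrans (j k : nat) (h : (j <= k)%N) (x : M j) : M k :=
  ecast i (M i) (subnK h) (pshift (k - j) x).

Lemma ptransE j k (h : (j <= k)%N) e (q : (e + j)%N = k) (x : M j) :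
  ptrans h x = ecast i (M i) q (pshift e x).
Proof.
have E : e = (k - j)%N by rewrite -q addnK.
by subst e; rewrite /ptrans (eq_irrelevance q (subnK h)).
Qed.

Lemma ptrans_id j (h : (j <= j)%N) (x : M j) : ptrans h x = x.
Proof. exact: (ptransE h (erefl : (0 + j)%N = j)). Qed.

Lemma ptransS j k (h : (j <= k)%N) (h' : (j <= k.+1)%N) (x : M j) :
  ptrans h' x = pmap (ptrans h x).
Proof.
have q : ((k - j) + j)%N = k by rewrite subnK.
rewrite (ptransE h q) (ptransE h' (congr1 S q : ((k - j).+1 + j)%N = k.+1)).
by move: (k - j)%N q => e; case: k / {h h'}.
Qed.

Lemma ptrans_comp i j k (hij : (i <= j)%N) (hjk : (j <= k)%N)
    (hik : (i <= k)%N) (x : M i) :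
  ptrans hjk (ptrans hij x) = ptrans hik x.
Proof.
elim: k hjk hik => [|k IHk] hjk hik.
  have j0 : j = 0 by apply/eqP; rewrite -leqn0.
  by subst j; rewrite ptrans_id (bool_irrelevance hij hik).
have [hjk'|] := leqP j k; last first.
  move=> hkj; have jE : j = k.+1 by apply/eqP; rewrite eqn_leq hjk hkj.
  by subst j; rewrite ptrans_id (bool_irrelevance hij hik).
have hik' := leq_trans hij hjk'.
by rewrite (ptransS hjk') (ptransS hik') IHk.
Qed.

Lemma ptrans_homo j k (h : (j <= k)%N) :
  {homo @ptrans j k h : x y / x <= y}.
Proof.
elim: k h => [|k IHk] h x y xy.
  have j0 : j = 0 by apply/eqP; rewrite -leqn0.
  by subst j; rewrite !ptrans_id.
have [h'|hkj] := leqP j k; last first.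
  have jE : j = k.+1 by apply/eqP; rewrite eqn_leq h hkj.
  by subst j; rewrite !ptrans_id.
by rewrite !(ptransS h'); apply: pmap_homo; apply: IHk.
Qed.

Definition laxsum (n : nat) : Type := {j : 'I_n.+1 & M j}.

HB.instance Definition _ n := Choice.on (laxsum n).

Definition laxsum_le n (u v : laxsum n) : bool :=
  if @idP (tag u <= tag v)%N is ReflectT h
  then ptrans h (tagged u) <= tagged v else false.

Lemma laxsum_leP n (u v : laxsum n) :
  reflect (exists h : (tag u <= tag v)%N, ptrans h (tagged u) <= tagged v)
          (laxsum_le u v).
Proof.
rewrite /laxsum_le; case: {-}_ / idP => [h|nh]; last by right; case.
apply: (iffP idP) => [le_uv|[h']]; first by exists h.
by rewrite (bool_irrelevance h h').
Qed.

Fact laxsum_le_refl n : reflexive (@laxsum_le n).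
Proof.
by move=> u; apply/laxsum_leP; exists (leqnn _); rewrite ptrans_id.
Qed.

Fact laxsum_le_anti n : antisymmetric (@laxsum_le n).
Proof.
move=> [j x] [k y] /andP[/laxsum_leP[/= h le_xy] /laxsum_leP[/= h' le_yx]].
have jk : j = k by apply/val_inj/eqP; rewrite /= eqn_leq h h'.
subst k; congr existT; apply/eqP.
by move: le_xy le_yx; rewrite !ptrans_id eq_le => -> ->.
Qed.

Fact laxsum_le_trans n : transitive (@laxsum_le n).
Proof.
move=> [k y] [j x] [l z] /laxsum_leP[/= h1 le1] /laxsum_leP[/= h2 le2].
apply/laxsum_leP; exists (leq_trans h1 h2) => /=.
rewrite -(ptrans_comp h1 h2); apply: le_trans le2.
exact: ptrans_homo.
Qed.

HB.instance Definition _ n := Order.Le_isPOrder.Build d (laxsum n)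
  (@laxsum_le_refl n) (@laxsum_le_anti n) (@laxsum_le_trans n).

Definition laxsum_map n (u : laxsum n) : laxsum n.+1 :=
  existT (fun j : 'I_n.+2 => M j) (widen_ord (leqnSn n.+1) (tag u)) (tagged u).

Fact laxsum_map_homo n : {homo @laxsum_map n : u v / u <= v}.
Proof.
by move=> u v /laxsum_leP[h le_uv]; apply/laxsum_leP; exists h.
Qed.

Definition laxsum_seq : posetSeq d :=
  @PosetSeq d (fun n => laxsum n : porderType d) laxsum_map laxsum_map_homo.

End LaxSum.

Definition laxsum_iter d (k : nat) (M : posetSeq d) : posetSeq d :=
  iter k (@laxsum_seq d) M.

(* C_m^n, the n-th power of the chain {0, ..., m}, in the product order. *)
Definition chain_pow (n m : nat) := n.-tupleprod 'I_m.+1.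

HB.instance Definition _ n m := Order.DistrLattice.on (chain_pow n m).

Definition chain_incl n m (x : chain_pow n m) : chain_pow n m.+1 :=
  [tuple of map (widen_ord (leqnSn m.+1)) x].

Fact chain_incl_homo n m : {homo @chain_incl n m : x y / x <= y}.
Proof.
move=> x y; rewrite !leEtprod => /forallP le_xy.
by apply/forallP => i; rewrite !tnth_map; apply: le_xy.
Qed.

Definition chain_seq n :=
  @PosetSeq _ (fun m => chain_pow n m : porderType _)
            (@chain_incl n) (@chain_incl_homo n).

(* Coordinates are numbered from 0: x_1, ..., x_n are at positions 0, ..., n-1
   and x_(n+1), ..., x_(n+k) at positions n, ..., n+k-1. *)
Definition tail_dominated (n k m : nat) : pred (chain_pow (n + k) m) :=
  fun x => [forall i : 'I_(n + k), forall j : 'I_(n + k),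
    ((i < n)%N && (j == n :> nat)) || ((n <= i)%N && (j == i.+1 :> nat))
    ==> (tnth x i <= tnth x j)].

Definition tail_poset (n k m : nat) : Type :=
  {x : chain_pow (n + k) m | tail_dominated x}.

HB.instance Definition _ n k m := SubChoice.on (tail_poset n k m).
HB.instance Definition _ n k m :=
  [SubChoice_isSubPOrder of tail_poset n k m by <:
    with Order.seqprod_display Order.OrdinalOrder.ord_display].

Definition sublattice d (L : latticeType d) (S : pred L) : Prop :=
  Order.ClosedPredicates.meet_closed S /\ Order.ClosedPredicates.join_closed S.

Definition poset_iso d d' (P : porderType d) (Q : porderType d') : Prop :=
  exists2 f : P -> Q, bijective f & {mono f : x y / x <= y}.

(* Main.v *)
(** Writing an element of the [k.+1]-st lax sum as a pair [(x, j)], append [j]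
    to the coordinates of [x].  The transition maps leave coordinates unchanged,
    so the lax order is exactly the componentwise one; and a coordinate vector
    lies in the image iff its last entry bounds all the others, which is what
    restricting [x] to the index [j] means. *)
Require Import Defs.
From mathcomp Require Import all_boot all_order.

Set Implicit Arguments.
Unset Strict Implicit.
Unset Printing Implicit Defensive.

Import Order.TTheory.
Local Open Scope order_scope.

Lemma tail_dominatedP n k m (x : chain_pow (n + k) m) :
  reflect (forall i j : 'I_(n + k),
             ((i < n)%N && (j == n :> nat)) || ((n <= i)%N && (j == i.+1 :> nat)) ->
             tnth x i <= tnth x j)
          (tail_dominated x).
Proof.
apply: (iffP forallP) => [dom i j|dom i].
  by move/forallP/(_ j)/implyP: (dom i).
by apply/forallP => j; apply/implyP/dom.
Qed.

(** Meets and joins are computed coordinatewise and are monotone in both arguments, so they preserve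
    every inequality between two fixed coordinates. *)
Lemma tail_dominated_sublattice n k m : sublattice (@tail_dominated n k m).
Proof.
split=> x y /tail_dominatedP dx /tail_dominatedP dy; apply/tail_dominatedP => i j ij.
  by rewrite !tnth_meet leI2 ?dx ?dy.
by rewrite !tnth_join leU2 ?dx ?dy.
Qed.

(** [bijective] asks for an actual inverse function; since [f u == v] is decidable, the choice
    structure on [T] selects a preimage. *)
Lemma inj_surj_bijective (T : choiceType) (U : eqType) (f : T -> U) :
  injective f -> (forall v, exists u, f u = v) -> bijective f.
Proof.
move=> f_inj f_surj.
have f_surjb v : exists u, f u == v by have [u <-] := f_surj v; exists u.
have fK v : f (xchoose (f_surjb v)) = v by apply/eqP/(xchooseP (f_surjb v)).
by exists (fun v => xchoose (f_surjb v)) => // u; apply: f_inj; rewrite fK.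
Qed.

Section Coordinates.
Variable n : nat.

(** The values are bare naturals whose type does not mention [m], so elements over different indices
    compare without casts. Positions from [n + k] on read 0. *)
Fixpoint coord k : forall m, laxsum_iter k (chain_seq n) m -> nat -> nat :=
  match k with
  | 0 => fun m (x : chain_pow n m) i => nth 0 (map val x) i
  | k'.+1 => fun m (u : laxsum (laxsum_iter k' (chain_seq n)) m) i =>
      if i == (n + k')%N then tag u : nat else coord (tagged u) i
  end.

Lemma coord_pmap k m (u : laxsum_iter k (chain_seq n) m) :
  coord (Defs.pmap u) =1 coord u.
Proof.
case: k u => [|k] u i //=.
by rewrite -map_comp; congr nth; apply: eq_map.
Qed.

Lemma coord_ptrans k j m (h : (j <= m)%N) (u : laxsum_iter k (chain_seq n) j) :
  coord (ptrans h u) =1 coord u.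
Proof.
move=> i; rewrite /ptrans; move: (m - j)%N (subnK h) => e q.
(* With [m - j] generalized to [e], eliminating the equation [q] removes the cast. *)
by case: m / q {h} => /=; elim: e => //= e <-; rewrite coord_pmap.
Qed.

Lemma coord_chain m (x : chain_pow n m) (i : 'I_n) :
  @coord 0 m x i = tnth x i.
Proof. by rewrite /= (nth_map ord0) ?size_tuple // (tnth_nth ord0). Qed.

Lemma coord_le k m (u : laxsum_iter k (chain_seq n) m) i :
  (i < n + k)%N -> (coord u i <= m)%N.
Proof.
elim: k m u => [|k IHk] m u.
  by rewrite addn0 => lt_in; rewrite (coord_chain u (Ordinal lt_in)) -ltnS.
rewrite addnS ltnS leq_eqVlt /=.
have le_um : (tag u <= m)%N by rewrite -ltnS.
case: eqP => //= _ /IHk le_i; exact: leq_trans (le_i _ _) le_um.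
Qed.

(** At level [k.+1], position [n + k] compares the tags; the other positions compare the fibres over
    [tag v], because transport along [ptrans] keeps coordinates. *)
Lemma coord_leP k m (u v : laxsum_iter k (chain_seq n) m) :
  reflect (forall i, (i < n + k)%N -> (coord u i <= coord v i)%N) (u <= v).
Proof.
elim: k m u v => [|k IHk] m u v.
  rewrite addn0 [u <= v]leEtprod; apply: (iffP forallP) => [le_uv i lt_in|le_uv i].
    rewrite (coord_chain u (Ordinal lt_in)) (coord_chain v (Ordinal lt_in)).
    exact: le_uv.
  by rewrite leEord -!coord_chain; apply: le_uv.
rewrite addnS; apply: (iffP (laxsum_leP _ _)) => [[h /IHk le_uv] i|le_uv].
  rewrite ltnS leq_eqVlt /=; case: eqP => //= _ /le_uv.
  by rewrite coord_ptrans.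
have h : (tag u <= tag v)%N by have := le_uv _ (ltnSn _); rewrite /= eqxx.
exists h; apply/IHk => i lt_i; rewrite coord_ptrans.
by have := le_uv i (ltnW lt_i); rewrite /= ltn_eqF.
Qed.

(** This is [tail_dominated] for raw sequences. The guard [0 < k] is there because for [k = 0]
    position [n] lies outside the vector. *)
Definition tail_bound k (s : nat -> nat) :=
  (0 < k -> forall i, i < n -> s i <= s n)%N /\
  (forall i, n <= i -> i.+1 < n + k -> s i <= s i.+1)%N.

Lemma tail_bound_last k s i :
  tail_bound k.+1 s -> (i <= n + k)%N -> (s i <= s (n + k))%N.
Proof.
case=> s_head s_tail le_i.
(* One induction climbs from [n] and descends from [n + k]. The climb with [e = k] serves positions
   below [n], the descent with [e = n + k - i] the others. *)
have le_last e : (e <= k)%N -> (s n <= s (n + e))%N /\ (s (n + (k - e)) <= s (n + k))%N.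
  elim: e => [|e IHe] lt_ek; first by rewrite addn0 subn0.
  have [le1 le2] := IHe (ltnW lt_ek); split.
    rewrite addnS; apply: leq_trans le1 (s_tail _ (leq_addr _ _) _).
    by rewrite addnS ltnS -addnS leq_add2l.
  apply: leq_trans le2; rewrite -(subnSK lt_ek) addnS s_tail ?leq_addr //.
  by rewrite addnS ltnS -addnS leq_add2l subnSK // leq_subr.
have [lt_in|le_ni] := ltnP i n.
  by apply: leq_trans (s_head isT _ lt_in) (le_last k (leqnn k)).1.
have := (le_last (n + k - i)%N _).2.
rewrite leq_subLR leq_add2r => /(_ le_ni).
suff -> : (n + (k - (n + k - i)) = i)%N by [].
by rewrite addnBA ?leq_subLR ?leq_add2r // subKn.
Qed.

Lemma tail_boundW k s : tail_bound k.+1 s -> tail_bound k s.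
Proof.
case=> s_head s_tail; split=> [_|i le_ni lt_i]; first exact: s_head.
by apply: s_tail; rewrite // addnS ltnW.
Qed.

Lemma coord_tail_bound k m (u : laxsum_iter k (chain_seq n) m) :
  tail_bound k (coord u).
Proof.
elim: k m u => [|k IHk] m u.
  by split=> // i le_ni; rewrite addn0 => /ltnW; rewrite ltnNge le_ni.
have [u_head u_tail] := IHk _ (tagged u).
have le_tag i : (i < n + k)%N -> (coord (tagged u) i <= tag u)%N by apply: coord_le.
split=> [_ i lt_in|i le_ni] /=.
  rewrite ltn_eqF ?ltn_addr // -[X in X == _]addn0 eqn_add2l.
  (* Position [n] is the newly added one exactly when [k = 0], and then the tag bounds the entry;
     otherwise the inequality comes from the fibre. *)
  by case: eqP => [_|/eqP]; rewrite ?le_tag ?ltn_addr // eq_sym -lt0n => /u_head->.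
rewrite addnS ltnS => lt_i; rewrite (ltn_eqF lt_i).
case: eqP => [_|/eqP ne_i]; first exact: le_tag.
by rewrite u_tail // ltn_neqAle ne_i.
Qed.

(** The last entry [s (n + k)] serves as the tag; by [tail_bound_last] it bounds the remaining
    entries, so induction applies with it in place of [m]. *)
Lemma coord_surj k m (s : nat -> nat) :
    tail_bound k s -> (forall i, (i < n + k)%N -> (s i <= m)%N) ->
  exists u : laxsum_iter k (chain_seq n) m,
    forall i, (i < n + k)%N -> coord u i = s i.
Proof.
elim: k m => [|k IHk] m bs le_sm.
  exists ([tuple inord (s i) | i < n] : chain_pow n m) => i.
  rewrite addn0 => lt_in; rewrite (coord_chain _ (Ordinal lt_in)) tnth_mktuple.
  by rewrite inordK // ltnS le_sm ?addn0.
have lt_last : (s (n + k) < m.+1)%N by rewrite ltnS le_sm // addnS.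
have [|x xE] := IHk (s (n + k)%N) (tail_boundW bs).
  by move=> i /ltnW; apply: tail_bound_last.
exists (existT (fun j : 'I_m.+1 => laxsum_iter k (chain_seq n) j)
               (Ordinal lt_last) x) => i.
by rewrite addnS ltnS leq_eqVlt /=; case: eqP => [->|_ /xE].
Qed.

Definition coord_tuple k m (u : laxsum_iter k (chain_seq n) m) :
  chain_pow (n + k) m := [tuple inord (coord u i) | i < n + k].

Lemma tnth_coord_tuple k m (u : laxsum_iter k (chain_seq n) m) (i : 'I_(n + k)) :
  tnth (coord_tuple u) i = coord u i :> nat.
Proof. by rewrite tnth_mktuple inordK // ltnS coord_le. Qed.

Lemma coord_tuple_dominated k m (u : laxsum_iter k (chain_seq n) m) :
  tail_dominated (coord_tuple u).
Proof.
have [u_head u_tail] := coord_tail_bound u.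
apply/tail_dominatedP => i j; rewrite leEord !tnth_coord_tuple.
case/orP=> /andP[le_i /eqP jE]; have := ltn_ord j; rewrite jE.
  (* Here [j = n], so [j < n + k] yields the guard [0 < k]. *)
  by rewrite -[X in (X < _)%N]addn0 ltn_add2l => /u_head; apply.
exact: u_tail.
Qed.

Definition tail_of_laxsum k m (u : laxsum_iter k (chain_seq n) m) :
  tail_poset n k m := exist _ (coord_tuple u) (coord_tuple_dominated u).

Lemma tail_of_laxsum_mono k m : {mono @tail_of_laxsum k m : u v / u <= v}.
Proof.
move=> u v; rewrite -[LHS]/(coord_tuple u <= coord_tuple v) leEtprod.
apply/forallP/coord_leP => le_uv i.
  by move=> lt_i; have := le_uv (Ordinal lt_i); rewrite leEord !tnth_coord_tuple.
by rewrite leEord !tnth_coord_tuple le_uv.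
Qed.

Lemma tail_of_laxsum_surj k m (t : tail_poset n k m) :
  exists u : laxsum_iter k (chain_seq n) m, tail_of_laxsum u = t.
Proof.
case: t => x dom_x; pose s i := nth 0 (map val x) i.
have sE (i : 'I_(n + k)) : s i = tnth x i.
  by rewrite /s (nth_map ord0) ?size_tuple // (tnth_nth ord0).
have le_s (i j : nat) : (i < n + k)%N -> (j < n + k)%N ->
    ((i < n)%N && (j == n)) || ((n <= i)%N && (j == i.+1)) -> (s i <= s j)%N.
  move=> lt_i lt_j ij; rewrite (sE (Ordinal lt_i)) (sE (Ordinal lt_j)).
  exact: (tail_dominatedP _ dom_x).
have [|i lt_i|u uE] := @coord_surj k m s.
- split=> [k_gt0 i lt_in|i le_ni lt_i].
    have lt_n : (n < n + k)%N by rewrite -[X in (X < _)%N]addn0 ltn_add2l.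
    by apply: le_s => //; [apply: ltn_trans lt_n | rewrite lt_in eqxx].
  by apply: le_s; rewrite ?le_ni ?eqxx ?orbT // ltnW.
- by rewrite (sE (Ordinal lt_i)) -ltnS.
exists u; apply/val_inj/eq_from_tnth => i; apply/val_inj.
by rewrite /= tnth_coord_tuple uE // sE.
Qed.

End Coordinates.

Theorem theorem5p1 (m n k : nat) :
  sublattice (@tail_dominated n k m) /\
  poset_iso (laxsum_iter k (chain_seq n) m) (tail_poset n k m).
Proof.
split; first exact: tail_dominated_sublattice.
exists (@tail_of_laxsum n k m); last exact: tail_of_laxsum_mono.
apply: inj_surj_bijective; last exact: tail_of_laxsum_surj.
(* Reflecting the order gives injectivity by antisymmetry. *)
exact/inc_inj/tail_of_laxsum_mono.
Qed.
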